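(* Let $t\ge 2$ and let $K_{n_1,\dots,n_t}$ be a complete multipartite graph with vertex classes $V_1,\dots,V_t$ of sizes $n_1\le n_2\le\dots\le n_t$, where $n_t\ge 3$. Then there is a 1-selection $f$ attaining $\chi_1$ for which some color class of an optimal proper coloring of the 1-removed graph is $V_t\cup\{v_1\}$ with $v_1\in V_1$; that is, $$\chi_1(K_{n_1,\dots,n_t})=1+\chi_1(K_{n_1-1,n_2,\dots,n_{t-1}}).$$ In particular, if $n_1=1$ and $n_t\ge 3$, then $\chi_1(K_{n_1,\dots,n_t})=1+\chi_1(K_{n_2,\dots,n_{t-1}})$.
   Context: $K_{n_1,\dots,n_t}$ denotes the complete $t$-partite graph with vertex classes of sizes $n_1,\dots,n_t$ in which two vertices are adjacent iff they lie in different classes; a class of size 0 is simply omitted, and the graph with no vertices has $\chi_1=0$. A 1-selection of a graph $G=(V,E)$ is a map $f$ assigning to each vertex $v$ a set $f(v)$ of at most one edge incident with $v$. The 1-removed subgraph $G_f$ has vertex set $V$ and edge set $E\setminus\bigcup_{v\in V}f(v)$. The robust chromatic number is $\chi_1(G)=\min_f\chi(G_f)$ over all 1-selections $f$ of $G$. *)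

(* Defs.v *)
From mathcomp Require Import all_boot.

Set Implicit Arguments.
Unset Strict Implicit.
Unset Printing Implicit Defensive.

Record sgraph := SGraph {
  vertex :> finType;
  adj : rel vertex;
  adj_sym : symmetric adj;
  adj_irrefl : irreflexive adj }.

Definition edges (G : sgraph) : {set {set G}} :=
  [set [set p.1; p.2] | p : G * G & adj p.1 p.2].

Definition proper_coloring (G : sgraph) (k : nat) (c : {ffun G -> 'I_k}) : bool :=
  [forall x, forall y, adj x y ==> (c x != c y)].

Definition colorable (G : sgraph) (k : nat) : bool :=
  [exists c : {ffun G -> 'I_k}, proper_coloring c].

Lemma colorable_ex (G : sgraph) : exists k, colorable G k.
Proof.
exists #|G|; apply/existsP; exists [ffun x => enum_rank x].
apply/forallP => x; apply/forallP => y; apply/implyP => xy.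
rewrite !ffunE; apply/eqP => /enum_rank_inj exy.
by move: xy; rewrite exy adj_irrefl.
Qed.

Definition chromatic_number (G : sgraph) : nat := ex_minn (colorable_ex G).

Definition selection1 (G : sgraph) (f : {ffun G -> {set {set G}}}) : bool :=
  [forall v, (#|f v| <= 1) && (f v \subset [set e in edges G | v \in e])].

Section Removed.
Variables (G : sgraph) (f : {ffun G -> {set {set G}}}).

(* For x != y, the pair [set x; y] is an edge exactly when adj x y holds, so
   this is the graph with edge set edges G :\: \bigcup_v f v. *)
Definition removed_adj : rel G :=
  fun x y => adj x y && ([set x; y] \notin \bigcup_v f v).

Fact removed_adj_sym : symmetric removed_adj.
Proof. by move=> x y; rewrite /removed_adj adj_sym setUC. Qed.

Fact removed_adj_irrefl : irreflexive removed_adj.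
Proof. by move=> x; rewrite /removed_adj adj_irrefl. Qed.

Definition removed_subgraph : sgraph :=
  SGraph removed_adj_sym removed_adj_irrefl.

End Removed.

Definition robust_value (G : sgraph) (k : nat) : bool :=
  [exists f : {ffun G -> {set {set G}}},
     selection1 f && (chromatic_number (removed_subgraph f) == k)].

Lemma robust_value_ex (G : sgraph) : exists k, robust_value G k.
Proof.
pose f0 : {ffun G -> {set {set G}}} := [ffun=> set0].
exists (chromatic_number (removed_subgraph f0)); apply/existsP; exists f0.
rewrite eqxx andbT; apply/forallP => v.
by rewrite ffunE cards0 sub0set.
Qed.

Definition robust_chromatic_number (G : sgraph) : nat :=
  ex_minn (robust_value_ex G).

Section CompleteMultipartite.
Variable s : seq nat.

(* A vertex is a class index i together with an element of 'I_(nth 0 s i);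
   classes of size 0 thus contribute no vertex. *)
Definition multipartite_vertex : finType :=
  {i : 'I_(size s) & 'I_(nth 0 s i)}.

Definition multipartite_adj : rel multipartite_vertex :=
  fun x y => tag x != tag y.

Fact multipartite_adj_sym : symmetric multipartite_adj.
Proof. by move=> x y; rewrite /multipartite_adj eq_sym. Qed.

Fact multipartite_adj_irrefl : irreflexive multipartite_adj.
Proof. by move=> x; rewrite /multipartite_adj eqxx. Qed.

Definition complete_multipartite : sgraph :=
  SGraph multipartite_adj_sym multipartite_adj_irrefl.

(* Classes are numbered from 1: the class V_i has size nth 0 s i.-1. *)
Definition vertex_class (i : nat) : {set complete_multipartite} :=
  [set x : multipartite_vertex | (tag x).+1 == i].

End CompleteMultipartite.

(* Main.v *)
(** The inequality chi_1(G) <= k says that the vertices split into k sets, each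
    inducing a pseudoforest: orient every monochromatic edge away from the
    endpoint that selects it.  In a complete multipartite graph a set induces a
    pseudoforest iff all but one of its vertices lie in one class (a star), or it
    has at most two vertices in each of two classes (a 4-cycle), or it has at most
    three vertices.  A star absorbs a whole class and has room for one arbitrary
    vertex, a 4-cycle has room for two pairs from arbitrary classes, and a
    triangle has room for three arbitrary vertices.  So only the number of free
    places matters, not the way they are grouped, and k parts suffice iff an
    arithmetical condition on the class sizes holds ([cov] below).  The exchange
    arguments are then local: first make the largest class the leaf class of a
    star and delete it, then adjust the witness at the smallest class and one
    other class to save the place lost with the deleted star. *)

Require Import Defs.
From mathcomp Require Import all_boot zify.

Set Implicit Arguments.
Unset Strict Implicit.
Unset Printing Implicit Defensive.

(** * Arithmetic of covers by stars, 4-cycles and triangles *)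

(* n gives the class sizes.  The predicate l selects the leaf classes of the
   stars, q and r count the 4-cycles and the triangles, and d i pairs of class i
   are placed in 4-cycles.  The slack s counts additional single places. *)
Definition cov_witness (I : finType) (n : I -> nat) (k s : nat)
    (l : I -> bool) (d : I -> nat) (q r : nat) : Prop :=
  [/\ \sum_i l i + q + r <= k,
      \sum_i (if l i then 0 else d i) <= 2 * q
    & \sum_i (if l i then 0 else n i - 2 * d i) <= \sum_i l i + 3 * r + s].

Definition cov (I : finType) (n : I -> nat) (k s : nat) : Prop :=
  exists l d q r, cov_witness n k s l d q r.

Lemma sumD2 (I : finType) (i j : I) (f : I -> nat) :
  i != j -> \sum_x f x = f i + f j + \sum_(x | (x != i) && (x != j)) f x.
Proof. by move=> ij; rewrite (bigD1 i) //= (bigD1 j) 1?eq_sym //= addnA. Qed.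

Lemma sum_gt_ex (I : finType) (f : I -> nat) (i : I) :
  f i < \sum_x f x -> exists2 j, j != i & 0 < f j.
Proof.
rewrite (bigD1 i) //= -[X in X < _]addn0 ltn_add2l => h.
case: (boolP [exists j, (j != i) && (0 < f j)]) => [/existsP[j /andP[]]|/existsPn hn].
  by exists j.
move: h; rewrite big1 // => j ji; apply/eqP.
by have := hn j; rewrite ji lt0n negbK.
Qed.

Definition upd (I : eqType) (T : Type) (f : I -> T) (i : I) (a : T) : I -> T :=
  fun x => if x == i then a else f x.

Lemma updE (I : eqType) (T : Type) (f : I -> T) (i : I) (a : T) : upd f i a i = a.
Proof. by rewrite /upd eqxx. Qed.

Lemma upd_neq (I : eqType) (T : Type) (f : I -> T) (i x : I) (a : T) :
  x != i -> upd f i a x = f x.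
Proof. by rewrite /upd => /negbTE->. Qed.

(* R1, R2, R3 are the contributions of the classes other than i and j, so a
   modification of the witness at i and j reduces to linear arithmetic. *)
Lemma cov_witness_upd2 (I : finType) (n n' : I -> nat) (k s : nat) (i j : I)
    (l : I -> bool) (d : I -> nat) (q r : nat) :
    i != j -> (forall x, x != i -> x != j -> n' x = n x) ->
    cov_witness n k s l d q r ->
  exists R1 R2 R3,
    [/\ [/\ l i + l j + R1 + q + r <= k,
            (if l i then 0 else d i) + (if l j then 0 else d j) + R2 <= 2 * q
          & (if l i then 0 else n i - 2 * d i) + (if l j then 0 else n j - 2 * d j)
            + R3 <= l i + l j + R1 + 3 * r + s],
        \sum_x l x = l i + l j + R1,
        \sum_x (if l x then 0 else n x - 2 * d x) =
          (if l i then 0 else n i - 2 * d i)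
          + (if l j then 0 else n j - 2 * d j) + R3
      & forall (bi bj : bool) (ui uj q' r' k' s' : nat),
          bi + bj + R1 + q' + r' <= k' ->
          (if bi then 0 else ui) + (if bj then 0 else uj) + R2 <= 2 * q' ->
          (if bi then 0 else n' i - 2 * ui) + (if bj then 0 else n' j - 2 * uj)
            + R3 <= bi + bj + R1 + 3 * r' + s' ->
          cov n' k' s'].
Proof.
move=> ij nn' [h1 h2 h3].
exists (\sum_(x | (x != i) && (x != j)) l x).
exists (\sum_(x | (x != i) && (x != j)) (if l x then 0 else d x)).
exists (\sum_(x | (x != i) && (x != j)) (if l x then 0 else n x - 2 * d x)).
rewrite !(sumD2 _ ij) in h1 h2 h3 *; split=> //.
move=> bi bj ui uj q' r' k' s' g1 g2 g3.
have Ei (T : Type) (f : I -> T) u v : upd (upd f j v) i u i = u by rewrite updE.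
have Ej (T : Type) (f : I -> T) u v : upd (upd f j v) i u j = v.
  by rewrite upd_neq 1?eq_sym // updE.
have E (T : Type) (f : I -> T) u v x :
    (x != i) && (x != j) -> upd (upd f j v) i u x = f x.
  by case/andP => xi xj; rewrite !upd_neq.
exists (upd (upd l j bj) i bi), (upd (upd d j uj) i ui), q', r'.
split; rewrite !(sumD2 _ ij) !Ei !Ej.
- by under eq_bigr => x xx do rewrite E //.
- by under eq_bigr => x xx do rewrite !E //.
under eq_bigr => x xx do rewrite !E // (nn' _ (proj1 (andP xx)) (proj2 (andP xx))).
by under [in X in _ <= X]eq_bigr => x xx do rewrite !E //.
Qed.

(** * Exchange arguments at the largest and the smallest class *)

(** If [t] is a leaf class, its star is dropped and the free place of that star becomes the slack.
    Otherwise [t] trades places with a leaf class or, when there are no stars, the places freed by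
    [t] allow a 4-cycle or a triangle to be dropped. *)
Lemma cov_remove_max (I : finType) (n : I -> nat) (k : nat) (a t : I) :
    a != t -> (forall i, n i <= n t) -> 2 < n t -> cov n k 0 ->
  0 < k /\ cov (upd n t 0) k.-1 1.
Proof.
move=> at_ nmax nt [l [d [q [r w]]]].
have U i : i != t -> upd n t 0 i = n i by exact: upd_neq.
have offt i x : x != i -> x != t -> upd n t 0 x = n x by move=> _; exact: upd_neq.
have [R1 [R2 [R3 [[h1 h2 h3] e1 e3 up]]]] := cov_witness_upd2 at_ (@offt a) w.
move: up; rewrite updE U // => up.
case lt: (l t); rewrite lt ?addn0 in h1 h2 h3 e1 e3.
  by split; first lia; apply: (up (l a) false (d a) 0 q r); lia.
case: (boolP [exists i, l i]) => [/existsP[i li]|/existsPn l0].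
  have it : i != t by apply: contraTneq li => ->; rewrite lt.
  have [S1 [S2 [S3 [[g1 g2 g3] _ _ iup]]]] := cov_witness_upd2 it (@offt i) w.
  move: iup; rewrite updE U // => iup; have := nmax i.
  rewrite lt li in g1 g2 g3.
  (* The star of [i] is dropped and [i] moves into the places of [t], which suffice since
     [n i <= n t]. *)
  by split; first lia; apply: (iup false false (d t) 0 q r); lia.
have {}l0 x : l x = false by apply/negbTE.
have sl0 : \sum_i l i = 0 by rewrite big1 // => i _; rewrite l0.
rewrite l0 in h1 h2 h3 e1 e3.
split; first by lia.
(* Two pairs of [t] pay for a 4-cycle; two single vertices of [t] and the slack pay for a
   triangle. *)
have [dt|dt] := leqP 2 (d t).
  by apply: (up false false (d a) 0 q.-1 r); lia.
have [nd|nd] := leqP 2 (n t - 2 * d t).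
  by apply: (up false false (d a) 0 q r.-1); lia.
(* What remains is [n t = 3] with [d t = 1]: one pair and one single vertex. *)
have [R3s|R3b] := leqP (n a - 2 * d a + R3 + 2) (3 * r).
  by apply: (up false false (d a) 0 q r.-1); lia.
have [j jt] : exists2 j, j != t & 0 < if l j then 0 else n j - 2 * d j.
  by apply: sum_gt_ex; rewrite e3 lt; lia.
rewrite l0 => nj.
have [S1 [S2 [S3 [[g1 g2 g3] f1 f3 jup]]]] := cov_witness_upd2 jt (@offt j) w.
move: jup; rewrite updE U // => jup; rewrite !l0 in g1 g2 g3 f1 f3.
(* [j] inherits the pair place of [t], which absorbs a single vertex of [j]; with the single vertex
   of [t] and the slack this pays for a triangle. *)
by apply: (jup false false (d j).+1 0 q r.-1); lia.
Qed.

(** Only a cover that uses the slack has to change. If the deletion frees no single place of [a],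
    some other class [i] has a single vertex, and [n a <= n i] lets [a] and [i] exchange places so
    that one single place is saved. *)
Lemma cov_decr_min (I : finType) (n : I -> nat) (k : nat) (a b : I) :
    a != b -> 0 < n a -> (forall i, 0 < n i -> n a <= n i) -> cov n k 1 ->
  cov (upd n a (n a).-1) k 0.
Proof.
move=> ab na nmin [l [d [q [r w]]]].
have off i x : x != a -> x != i -> upd n a (n a).-1 x = n x.
  by move=> xa _; rewrite upd_neq.
have U i : a != i -> upd n a (n a).-1 i = n i by move=> ai; rewrite upd_neq // eq_sym.
have [R1 [R2 [R3 [[h1 h2 h3] e1 e3 up]]]] := cov_witness_upd2 ab (@off b) w.
move: up; rewrite updE U // => up.
have [full|full] := leqP (\sum_x (if l x then 0 else n x - 2 * d x)) (\sum_x l x + 3 * r).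
  apply: (up (l a) (l b) (d a) (d b) q r); move: full; rewrite e1 e3;
    by case: (l a) h1 h2 h3 {up e1 e3} => /=; lia.
have [/andP[la da]|sm] := boolP (~~ l a && (2 * d a < n a)).
  apply: (up (l a) (l b) (d a) (d b) q r); move: full; rewrite ?e1 ?e3;
    by rewrite (negbTE la) in h1 h2 h3 e1 e3 *; lia.
have [i ia] : exists2 i, i != a & 0 < if l i then 0 else n i - 2 * d i.
  by apply: sum_gt_ex; case: (l a) sm full => /=; lia.
case li: (l i) => // ni; rewrite eq_sym in ia.
have nai : n a <= n i by apply: nmin; lia.
have [S1 [S2 [S3 [[g1 g2 g3] f1 f3 iup]]]] := cov_witness_upd2 ia (@off i) w.
move: iup; rewrite updE U // => iup; rewrite li in g1 g2 g3 f1 f3.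
case la: (l a) sm; rewrite la in g1 g2 g3 f1 f3 => /= sm.
  (* [i] becomes the leaf class, and the shrunken [a] takes the former places of [i]. *)
  by apply: (iup false true (d i) 0 q r); lia.
rewrite -leqNgt in sm.
have [l1|l1] := ltnP (n a) (2 * d a).
  by apply: (iup false false (d a).-1 (d i).+1 q r); lia.
(* From here on [n a = 2 * d a], so the deletion leaves an odd number of vertices in [a]. *)
have [l2|l2] := leqP (2 * d i) (n a).-1.
  by apply: (iup false false (d i) (d a) q r); lia.
have [l3|l3] := leqP (2 * d i + 2) (n i).
  by apply: (iup false false (d a).-1 (d i).+1 q r); lia.
(* Now [n i = 2 * d i + 1] and [0 < d a <= d i]. A star with leaf class [i] replaces a 4-cycle, paid
   for by pairs of [a] and [i]; its free place takes the odd vertex of [a]. *)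
by apply: (iup false true (d a).-1 0 q.-1 r); lia.
Qed.

(** * Adding and removing a single part *)

(* In the second case p i is the number of pairs of class i in a 4-cycle. *)
Definition pf_profile (I : finType) (m : I -> nat) : Prop :=
  [\/ exists C, \sum_i (if i == C then 0 else m i) <= 1,
      exists2 p : I -> nat, \sum_i p i <= 2 & forall i, m i <= 2 * p i
    | \sum_i m i <= 3].

Lemma cov_add_profile (I : finType) (n n0 m : I -> nat) (k : nat) :
    (forall i, n i <= n0 i + m i) -> pf_profile m -> cov n0 k 0 -> cov n k.+1 0.
Proof.
move=> nn pm [l [d [q [r [h1 h2 h3]]]]].
have split_sum (l' : I -> bool) d' p :
    (forall i, l i -> l' i) ->
    (forall i, ~~ l' i -> n i - 2 * d' i <= n0 i - 2 * d i + p i) ->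
  \sum_i (if l' i then 0 else n i - 2 * d' i) <=
  \sum_i (if l i then 0 else n0 i - 2 * d i) + \sum_i p i.
  move=> ll' hp; rewrite -big_split leq_sum //= => i _.
  case li': (l' i) => //; have := hp i; rewrite li' => /(_ isT).
  by case li: (l i) => //; rewrite ll' in li'.
case: pm => [[C hC]|[p hp mp]|hm].
- have [lC|lC] := boolP (l C).
    (* [C] is a leaf class already, so only the vertex outside [C], if any, needs a place, and a
       triangle supplies it. *)
    exists l, d, q, r.+1; split=> //; first lia.
    have H i : ~~ l i -> n i - 2 * d i <= n0 i - 2 * d i + (if i == C then 0 else m i).
      by case: eqP => [->|_ _]; [rewrite lC|have := nn i; lia].
    by have := split_sum l d _ (fun _ => id) H; lia.
  have sl : \sum_i upd l C true i = (\sum_i l i).+1.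
    rewrite (bigD1 C) //= updE [in RHS](bigD1 C) //= (negbTE lC) add0n add1n.
    by congr _.+1; apply: eq_bigr => i iC; rewrite upd_neq.
  exists (upd l C true), d, q, r; split; rewrite ?sl; first lia.
    apply: leq_trans h2; apply: leq_sum => i _.
    by rewrite /upd; case: eqP => //; case: (l i).
  have H i : ~~ upd l C true i ->
      n i - 2 * d i <= n0 i - 2 * d i + (if i == C then 0 else m i).
    by rewrite /upd; case: eqP => // _ _; have := nn i; lia.
  have H' i : l i -> upd l C true i by rewrite /upd; case: eqP.
  by have := split_sum _ d _ H' H; lia.
- exists l, (fun i => d i + p i), q.+1, r; split; first by lia.
    have : \sum_i (if l i then 0 else d i + p i) <=
           \sum_i (if l i then 0 else d i) + \sum_i p i.
      by rewrite -big_split leq_sum //= => i _; case: (l i).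
    by lia.
  have := split_sum l (fun i => d i + p i) (fun=> 0); rewrite big1_eq => S.
  have H i : ~~ l i -> n i - 2 * (d i + p i) <= n0 i - 2 * d i + 0.
    by move=> _; have := nn i; have := mp i; lia.
  by have := S (fun _ => id) H; lia.
exists l, d, q, r.+1; split=> //; first lia.
have H i : ~~ l i -> n i - 2 * d i <= n0 i - 2 * d i + m i.
  by move=> _; have := nn i; lia.
by have := split_sum l d m (fun _ => id) H; lia.
Qed.

Lemma ex_sub_sum (I : finType) (f : I -> nat) (b : nat) :
  exists2 p : I -> nat, forall i, p i <= f i & \sum_i p i = minn b (\sum_i f i).
Proof.
elim: b => [|b [p pf sp]]; first by exists (fun=> 0); rewrite // big1_eq min0n.
have [le|lt] := leqP (\sum_i f i) b; first by exists p => //; rewrite sp; lia.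
have sd : \sum_i (f i - p i) = \sum_i f i - b.
  have : \sum_i (f i - p i) + \sum_i p i = \sum_i f i.
    by rewrite -big_split; apply: eq_bigr => i _; rewrite /= subnK.
  by rewrite sp; lia.
have [i0 fi] : exists i, 0 < f i - p i.
  case: (boolP [exists i, 0 < f i - p i]) => [/existsP //|/existsPn h].
  by move: sd; rewrite big1 => [|i _]; [lia|have := h i; lia].
exists (upd p i0 (p i0).+1).
  by move=> i; rewrite /upd; case: eqP => [->|]; [lia|].
rewrite (bigD1 i0) //= updE (eq_bigr p) => [|i ii]; last by rewrite upd_neq.
by move: sp; rewrite (bigD1 i0) //=; lia.
Qed.

(** A star is removed if there is one, else a 4-cycle, else a triangle, each with as many vertices
    as it can hold. *)
Lemma cov_sub_profile (I : finType) (n : I -> nat) (k : nat) :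
    cov n k.+1 0 ->
  exists m : I -> nat, [/\ forall i, m i <= n i, pf_profile m
    & cov (fun i => n i - m i) k 0].
Proof.
move=> [l [d [q [r [h1 h2 h3]]]]].
have leq_sumB (f g p : I -> nat) : (forall i, g i + p i <= f i) ->
    \sum_i g i + \sum_i p i <= \sum_i f i.
  by move=> H; rewrite -big_split leq_sum.
case: (boolP [exists i, l i]) => [/existsP[C lC]|/existsPn l0].
  have [p pf sp] := ex_sub_sum (fun i => if l i then 0 else n i - 2 * d i) 1.
  have sl : \sum_i l i = (\sum_i upd l C false i).+1.
    rewrite (bigD1 C) //= [in RHS](bigD1 C) //= updE lC add0n add1n.
    by congr _.+1; apply: eq_bigr => i iC; rewrite upd_neq.
  exists (fun i => if i == C then n C else p i); split.
  - by move=> i; case: eqP => [->|_] //; have := pf i; case: (l i); lia.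
  - apply: Or31; exists C.
    have : \sum_i (if i == C then 0 else if i == C then n C else p i) <= \sum_i p i.
      by apply: leq_sum => i _; case: eqP.
    by rewrite sp; lia.
  exists (upd l C false), (upd d C 0), q, r; split; first by lia.
    by apply: leq_trans h2; apply: leq_sum => i _; rewrite /upd; case: eqP.
  have := @leq_sumB (fun i => if l i then 0 else n i - 2 * d i)
    (fun i => if upd l C false i then 0
              else n i - (if i == C then n C else p i) - 2 * upd d C 0 i) p.
  suff H i : (if upd l C false i then 0
              else n i - (if i == C then n C else p i) - 2 * upd d C 0 i) + p i
           <= if l i then 0 else n i - 2 * d i by move/(_ H); lia.
  rewrite /upd; case: eqP => [->|_]; have := pf i; last by case: (l i) => //; lia.
  by have := pf C; rewrite lC; lia.
have {}l0 x : l x = false by apply/negbTE.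
have sl0 : \sum_i l i = 0 by rewrite big1 // => i _; rewrite l0.
have E (f : I -> nat) : \sum_i (if l i then 0 else f i) = \sum_i f i.
  by apply: eq_bigr => i _; rewrite l0.
rewrite !E in h2 h3.
case: q => [|q] in h1 h2 *.
  have [p pf sp] := ex_sub_sum (fun i => n i - 2 * d i) 3.
  exists p; split; first by move=> i; have := pf i; lia.
    by apply: Or33; rewrite sp; lia.
  (* If [r = 0], no single vertices are left, so the truncation in [r.-1] is harmless. *)
  exists l, d, 0, r.-1; split; rewrite ?E; try by lia.
  have H i : n i - p i - 2 * d i + p i <= n i - 2 * d i by have := pf i; lia.
  by have := leq_sumB _ _ _ H; lia.
have [p pf sp] := ex_sub_sum d 2.
(* The minimum is taken because pair places may be only partly filled. *)
exists (fun i => minn (n i) (2 * p i)); split; first by move=> i; exact: geq_minl.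
  by apply: Or32; exists p => [|i]; [rewrite sp|]; lia.
exists l, (fun i => d i - p i), q, r; split; rewrite ?E; first by lia.
  have H i : d i - p i + p i <= d i by have := pf i; lia.
  by have := leq_sumB _ _ _ H; lia.
by apply: leq_trans h3; apply: leq_sum => i _; have := pf i; lia.
Qed.

(** * Pseudoforests in multipartite graphs *)

(** An orientation of the edges inside [X] with out-degree at most one: [g x] is the head of the arc
    leaving [x], and is arbitrary if there is no such arc. *)
Definition pseudoforest (G : sgraph) (X : {set G}) : Prop :=
  exists g : G -> G, {in X &, forall x y, adj x y -> g x = y \/ g y = x}.

Definition cnt (T I : finType) (cl : T -> I) (X : {set T}) (i : I) : nat :=
  #|[set x in X | cl x == i]|.

Lemma sum_cnt (T I : finType) (cl : T -> I) (P : pred I) (X : {set T}) :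
  \sum_(i | P i) cnt cl X i = #|[set x in X | P (cl x)]|.
Proof.
rewrite -sum1_card (partition_big cl P) => [|x]; last by rewrite inE => /andP[].
apply: eq_bigr => i Pi; rewrite /cnt -sum1_card; apply: eq_bigl => x.
by rewrite !inE; case: eqP => [->|]; rewrite ?andbF // Pi !andbT.
Qed.

Lemma cntD (T I : finType) (cl : T -> I) (U X : {set T}) (i : I) :
  X \subset U -> cnt cl (U :\: X) i = cnt cl U i - cnt cl X i.
Proof.
move=> XU; rewrite /cnt -cardsDS; last first.
  by apply/subsetP => x; rewrite !inE => /andP[/(subsetP XU)->].
by apply: eq_card => x; rewrite !inE negb_and; case: (cl x == i); rewrite ?andbF ?andbT ?orbF.
Qed.

Lemma ex_subset_cnt (T I : finType) (cl : T -> I) (U : {set T}) (m : I -> nat) :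
    (forall i, m i <= cnt cl U i) ->
  exists2 X : {set T}, X \subset U & forall i, cnt cl X i = m i.
Proof.
move=> mU; pose A i := enum [set x in U | cl x == i].
have inA i x : x \in A i = (x \in U) && (cl x == i) by rewrite mem_enum inE.
exists [set x | x \in take (m (cl x)) (A (cl x))].
  by apply/subsetP => x; rewrite inE => /mem_take; rewrite inA => /andP[].
move=> i; have -> : m i = size (take (m i) (A i)).
  by rewrite size_takel // /A -cardE; exact: mU.
have /card_uniqP <- : uniq (take (m i) (A i)) by rewrite take_uniq ?enum_uniq.
apply: eq_card => x; rewrite !inE.
apply/andP/idP => [[xA /eqP <-] //|xA].
by have := mem_take xA; rewrite inA => /andP[_ /eqP e]; rewrite e.
Qed.

Lemma card_le2_sub (T : finType) (A : {set T}) (x : T) :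
  x \in A -> #|A| <= 2 -> exists y, A \subset [set x; y].
Proof.
move=> xA; rewrite (cardsD1 x) xA => cA.
have [A0|[y yA]] := set_0Vmem (A :\ x).
  by exists x; rewrite -(setD1K xA) A0 setU0 subsetUl.
exists y; rewrite -(setD1K xA) setUS //.
have/cards1P[z e] : #|A :\ x| == 1.
  by rewrite eqn_leq -ltnS cA card_gt0; apply/set0Pn; exists y.
by move: yA; rewrite e inE => /eqP->.
Qed.

Lemma card_le3_sub (T : finType) (A : {set T}) (x : T) :
  x \in A -> #|A| <= 3 -> exists y z, A \subset [set x; y; z].
Proof.
move=> xA; rewrite (cardsD1 x) xA => cA.
have [A0|[y yA]] := set_0Vmem (A :\ x).
  by exists x, x; rewrite -(setD1K xA) A0 setU0 -setUA subsetUl.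
have [//|z Az] := card_le2_sub yA.
by exists y, z; rewrite -(setD1K xA) -setUA setUS.
Qed.

Lemma pseudoforest_of_profile (G : sgraph) (I : finType) (cl : G -> I)
    (X : {set G}) :
    (forall x y : G, adj x y -> cl x != cl y) ->
  pf_profile (cnt cl X) -> pseudoforest X.
Proof.
move=> hcl; have [->|[x0 x0X]] := set_0Vmem X.
  by exists id => x y; rewrite inE.
case=> [[C hC]|[p sp hp]|].
- move: hC; have -> : \sum_i (if i == C then 0 else cnt cl X i)
            = #|[set x in X | cl x != C]|.
    by rewrite -(sum_cnt _ (fun i => i != C)) [RHS]big_mkcond; apply: eq_bigr => i _; case: eqP.
  move=> hC; have [A0|[v vA]] := set_0Vmem [set x in X | cl x != C].
    exists id => x y xX yX xy; have := hcl _ _ xy.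
    have := in_set0 x; have := in_set0 y; rewrite -A0 !inE xX yX /=.
    by move=> /negbFE/eqP-> /negbFE/eqP->; rewrite eqxx.
  have only x : x \in X -> cl x != C -> v = x.
    move=> xX xC; apply: (card_le1_eqP hC) => //.
    by rewrite inE xX.
  exists (fun=> v) => x y xX yX xy.
  have [xC|xC] := eqVneq (cl x) C; last by right; exact: only.
  by left; apply: only => //; rewrite -xC eq_sym hcl.
- have px x : x \in X -> 0 < p (cl x).
    move=> xX; have := hp (cl x).
    have : 0 < cnt cl X (cl x) by rewrite card_gt0; apply/set0Pn; exists x; rewrite inE xX eqxx.
    by lia.
  case: (boolP [exists y in X, cl y != cl x0]) => [/exists_inP[y0 y0X ne]|/exists_inPn same]; last first.
    exists id => x y xX yX /hcl; have := same _ xX; have := same _ yX.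
    by rewrite !negbK => /eqP-> /eqP->; rewrite eqxx.
  (* [p] is positive on every class met by [X] and sums to at most 2, so only the classes of [x0]
     and [y0] occur, with value 1 each. *)
  move: sp; rewrite (sumD2 _ ne) => sp.
  have := px _ x0X; have := px _ y0X => py0 px0.
  have two x : x \in X -> cl x = cl x0 \/ cl x = cl y0.
    move=> xX; have [|n1] := eqVneq (cl x) (cl x0); first by left.
    have [|n2] := eqVneq (cl x) (cl y0); first by right.
    by move: sp; rewrite (bigD1 (cl x)) ?n1 ?n2 //=; have := px _ xX; lia.
  have pair z : z \in X -> p (cl z) = 1 ->
      exists z1, [set x in X | cl x == cl z] \subset [set z; z1].
    move=> zX pz; apply: card_le2_sub; first by rewrite inE zX eqxx.
    by have := hp (cl z); rewrite pz.
  have [x1 sx] := pair x0 x0X ltac:(lia).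
  have [y1 sy] := pair y0 y0X ltac:(lia).
  (* The 4-cycle x0 -> y0 -> x1 -> y1 -> x0. *)
  pose g x := if cl x == cl x0 then (if x == x0 then y0 else y1)
              else if x == y0 then x1 else x0.
  have inx x : x \in X -> cl x = cl x0 -> x != x0 -> x = x1.
    move=> xX e; have := subsetP sx x; rewrite !inE xX e eqxx => /(_ isT).
    by case/orP => /eqP -> //; rewrite eqxx.
  have iny x : x \in X -> cl x = cl y0 -> x != y0 -> x = y1.
    move=> xX e; have := subsetP sy x; rewrite !inE xX e eqxx => /(_ isT).
    by case/orP => /eqP -> //; rewrite eqxx.
  have key x y : x \in X -> y \in X -> cl x = cl x0 -> cl y = cl y0 ->
      g x = y \/ g y = x.
    move=> xX yX ex ey; rewrite /g ex ey eqxx (negbTE ne).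
    have [xe|xe] := eqVneq x x0; have [ye|ye] := eqVneq y y0.
    + by left.
    + by right.
    + by right; rewrite (inx x).
    + by left; rewrite (iny y).
  exists g => x y xX yX /hcl xy.
  case: (two x xX) (two y yX) => ex [] ey; try by rewrite ex ey eqxx in xy.
    exact: key.
  by case: (key y x yX xX ey ex); [right|left].
have -> : \sum_i cnt cl X i = #|X|.
  by rewrite sum_cnt; apply: eq_card => x; rewrite !inE andbT.
move=> cX; have [b [c sX]] := card_le3_sub x0X cX.
exists (fun x => if x == x0 then b else if x == b then c else x0) => x y xX yX xy.
have {}xy : x != y by apply: contraTneq xy => ->; rewrite adj_irrefl.
have := subsetP sX _ xX; have := subsetP sX _ yX; rewrite !inE -!orbA.
case: (eqVneq x x0) (eqVneq x b) (eqVneq x c) xy => [->|xa] [xb|xb] [xc|xc] //=;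
case: (eqVneq y x0) (eqVneq y b) (eqVneq y c) => [ya|ya] [yb|yb] [yc|yc] //=;
by subst; rewrite ?eqxx //; move=> *; try (by left); try (by right).
Qed.

(** A pseudoforest has no more edges than vertices, which rules out K_{2,3} and K_{1,1,2}. Beyond
    three vertices, a class with three of them forces a star, a class with two leaves room for only
    one other class, and four distinct classes are impossible. *)
Lemma profile_of_pseudoforest (G : sgraph) (I : finType) (cl : G -> I)
    (X : {set G}) :
    (forall x y : G, cl x != cl y -> adj x y) ->
  pseudoforest X -> pf_profile (cnt cl X).
Proof.
move=> hcl [g hg]; have [X3|X4] := leqP #|X| 3.
  by apply: Or33; rewrite sum_cnt; apply: leq_trans X3;
    apply/subset_leq_card/subsetP => x; rewrite inE => /andP[].
have star C : #|[set x in X | cl x != C]| <= 1 -> pf_profile (cnt cl X).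
  move=> hC; apply: Or31; exists C; apply: leq_trans hC.
  rewrite -(sum_cnt _ (fun i => i != C)) [leqRHS]big_mkcond /=.
  by apply: leq_sum => i _; case: eqP.
(* K_{1,1,2} has five edges on four vertices. *)
have k112 a b c d : a \in X -> b \in X -> c \in X -> d \in X -> c != d ->
    cl a != cl b -> cl a != cl c -> cl a != cl d -> cl b != cl c -> cl b != cl d ->
    False.
  move=> aX bX cX dX cd ab ac ad bc bd.
  have ne x y : cl x != cl y -> x <> y by move=> /eqP xy e; rewrite e in xy.
  move/eqP in cd; move: (ne _ _ ab) (ne _ _ ac) (ne _ _ ad) (ne _ _ bc) (ne _ _ bd).
  move: (hg a b aX bX (hcl _ _ ab)) (hg a c aX cX (hcl _ _ ac))
     (hg a d aX dX (hcl _ _ ad)) (hg b c bX cX (hcl _ _ bc))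
     (hg b d bX dX (hcl _ _ bd)).
  by do 5!case=> ?; intuition congruence.
have [/existsP[C]|/existsPn le2] := boolP [exists C, 2 < cnt cl X C].
  (* K_{2,3} has six edges on five vertices. *)
  move/card_gt2P=> [x [y [z [[xC yC zC] [xy yz zx]]]]].
  have [/star //|/card_gt1P[a [b [aC bC ab]]]] := leqP #|[set x in X | cl x != C]| 1.
  move: xC yC zC aC bC; rewrite !inE => /andP[xX /eqP xC] /andP[yX /eqP yC] /andP[zX /eqP zC]
     /andP[aX aC] /andP[bX bC].
  have ka w : w \in X -> cl w = C -> g a = w \/ g w = a.
    by move=> wX wC; apply: hg => //; apply: hcl; rewrite wC.
  have kb w : w \in X -> cl w = C -> g b = w \/ g w = b.
    by move=> wX wC; apply: hg => //; apply: hcl; rewrite wC.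
  exfalso; move/eqP in xy; move/eqP in yz; move/eqP in zx; move/eqP in ab.
  case: (ka x) (kb x) => // ? [] // ?; case: (ka y) (kb y) => // ? [] // ?;
  case: (ka z) (kb z) => // ? [] // ?; congruence.
have {}le2 C : cnt cl X C <= 2 by rewrite leqNgt.
have [/existsP[C]|/existsPn small] := boolP [exists C, 1 < cnt cl X C].
  move/card_gt1P=> [c [d [cC dC cd]]].
  have [/star //|/card_gt1P[a [_ [aC _ _]]]] := leqP #|[set x in X | cl x != C]| 1.
  move: cC dC aC; rewrite !inE => /andP[cX /eqP cC] /andP[dX /eqP dC] /andP[aX aC].
  apply: Or32; exists (fun i => (i == C) + (i == cl a)).
    have one D : \sum_i (i == D) = 1.
      by rewrite (bigD1 D) //= eqxx big1 // => i /negbTE->.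
    by rewrite big_split /= !one.
  move=> i; have [_|iC] := eqVneq i C; first by have := le2 i; lia.
  have [_|ia] := eqVneq i (cl a); first by have := le2 i; lia.
  rewrite leqn0 cards_eq0; apply/eqP/setP => b; rewrite !inE; apply/negP.
  move=> /andP[bX /eqP bi]; subst i.
  by apply: (k112 a b c d); rewrite ?cC ?dC // eq_sym.
have inj x y : x \in X -> y \in X -> x != y -> cl x != cl y.
  move=> xX yX xy; apply: contraNneq xy => e; apply/eqP.
  have := small (cl x); rewrite -leqNgt => /card_le1_eqP; apply; rewrite !inE ?xX ?yX ?e eqxx //.
(* Four vertices in distinct classes span K_4, which contains K_{1,1,2}. *)
have [a aX] : exists a, a \in X by apply/set0Pn; rewrite -card_gt0; lia.
have : 2 < #|X :\ a| by rewrite (cardsD1 a) aX in X4.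
move/card_gt2P=> [x [y [z [[]]]]]; rewrite !inE => /andP[xa xX] /andP[ya yX] /andP[za zX] [xy yz zx].
by exfalso; apply: (k112 a x y z); rewrite // inj // eq_sym.
Qed.

(** * Colorings by pseudoforests *)

(** Colors are plain numbers bounded on [U] only, so that [U] can shrink in an induction while the
    type of [c] stays fixed. *)
Definition pf_coloring (G : sgraph) (U : {set G}) (k : nat) (c : G -> nat) : Prop :=
  {in U, forall x, c x < k} /\ forall a, pseudoforest [set x in U | c x == a].

Lemma pseudoforest_sub (G : sgraph) (X Y : {set G}) :
  X \subset Y -> pseudoforest Y -> pseudoforest X.
Proof.
by move=> /subsetP XY [g hg]; exists g => x y /XY xY /XY yY; exact: hg.
Qed.

Lemma pf_coloring_extend (G : sgraph) (U X : {set G}) (k : nat) (c : G -> nat) :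
    pseudoforest X -> pf_coloring (U :\: X) k c ->
  pf_coloring U k.+1 (fun x => if x \in X then k else c x).
Proof.
move=> pX [ck cp]; split=> [x xU|a].
  by case: ifPn => // xX; rewrite ltnS ltnW // ck // inE xX.
have [->|ak] := eqVneq a k.
  apply: pseudoforest_sub pX; apply/subsetP => x; rewrite inE => /andP[xU].
  by case: ifPn => // xX; rewrite ltn_eqF // ck // inE xX.
apply: pseudoforest_sub (cp a); apply/subsetP => x; rewrite !inE => /andP[->].
by case: ifPn => //; rewrite eq_sym (negbTE ak).
Qed.

(** Induction on [k]: the last color class is split off, and its profile is added to a cover of the
    rest. *)
Lemma cov_of_pf_coloring (G : sgraph) (I : finType) (cl : G -> I)
    (U : {set G}) (k : nat) (c : G -> nat) :
    (forall x y : G, cl x != cl y -> adj x y) ->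
  pf_coloring U k c -> cov (cnt cl U) k 0.
Proof.
move=> hcl; elim: k U => [|k IH] U [ck cp].
  have U0 x : cnt cl U x = 0.
    by apply/eqP; rewrite cards_eq0; apply/eqP/setP => y; rewrite !inE; case: (boolP (y \in U)) => // /ck.
  exists (fun=> false), (fun=> 0), 0, 0.
  by split; rewrite big1 // => i _; rewrite U0.
pose X := [set x in U | c x == k].
have XU : X \subset U by apply/subsetP => x; rewrite inE => /andP[].
apply: (@cov_add_profile _ _ (cnt cl (U :\: X)) (cnt cl X)).
- by move=> i; rewrite cntD //; lia.
- exact: profile_of_pseudoforest (cp k).
apply: IH; split=> [x|a].
  rewrite !inE => /andP[+ xU]; rewrite xU /= => xk.
  by have := ck _ xU; rewrite ltnS leq_eqVlt (negbTE xk).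
apply: pseudoforest_sub (cp a); apply/subsetP => x; rewrite !inE.
by case/andP => /andP[_ ->].
Qed.

(** Induction on [k]: a profile split off the cover is realized by a subset [X], which receives the
    new color. *)
Lemma pf_coloring_of_cov (G : sgraph) (I : finType) (cl : G -> I)
    (U : {set G}) (k : nat) :
    (forall x y : G, adj x y -> cl x != cl y) ->
  cov (cnt cl U) k 0 -> exists c, pf_coloring U k c.
Proof.
move=> hcl; elim: k U => [|k IH] U.
  move=> [l [d [q [r [h1 h2 h3]]]]].
  have {}h1 : \sum_i l i = 0 /\ q = 0 /\ r = 0 by lia.
  case: h1 => l0 [q0 r0]; move: h2 h3; rewrite l0 q0 r0 !leqn0 !sum_nat_eq0.
  move=> /forallP d0 /forallP n0; move/eqP: l0; rewrite sum_nat_eq0 => /forallP l0.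
  have U0 x : x \notin U.
    apply/negP => xU; have := l0 (cl x); have := d0 (cl x); have := n0 (cl x).
    rewrite /=; case: (l _) => //= nd /eqP d0x _.
    by move: nd; rewrite d0x muln0 subn0 cards_eq0 => /eqP/setP/(_ x); rewrite !inE xU eqxx.
  exists (fun=> 0); split=> [x|a]; first by rewrite (negbTE (U0 x)).
  by exists id => x y; rewrite inE (negbTE (U0 x)).
case/cov_sub_profile => m [mU pm cm].
have [X XU eX] := ex_subset_cnt mU.
have [|c hc] := IH (U :\: X).
  case: cm => l [d [q [r [h1 h2 h3]]]]; exists l, d, q, r; split=> //.
  by under eq_bigr => i _ do rewrite cntD // eX.
exists (fun x => if x \in X then k else c x); apply: pf_coloring_extend hc.
apply: pseudoforest_of_profile hcl _.
case: pm => [[C hC]|[p sp hp]|h].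
- by apply: Or31; exists C; under eq_bigr => i _ do rewrite eX.
- by apply: Or32; exists p => // i; rewrite eX.
- by apply: Or33; under eq_bigr => i _ do rewrite eX.
Qed.

(** * Robust chromatic number and pseudoforest colorings *)

Lemma chromatic_number_le (G : sgraph) (k : nat) :
  (chromatic_number G <= k) <->
  exists c : G -> nat, (forall x, c x < k) /\ forall x y, adj x y -> c x != c y.
Proof.
rewrite /chromatic_number; case: ex_minnP => m /existsP[c /forallP pc] min; split.
  move=> mk; exists (fun x => c x : nat); split=> [x|x y xy]; first exact: leq_trans (ltn_ord _) mk.
  by have /forallP/(_ y)/implyP/(_ xy) := pc x.
move=> [c' [ck pc']]; apply: min; apply/existsP; exists [ffun x => Ordinal (ck x)].
apply/forallP => x; apply/forallP => y; apply/implyP => xy; rewrite !ffunE.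
by rewrite -val_eqE /= pc'.
Qed.

(** Each vertex selects the edge leaving it in the orientation of its own color class, so every
    monochromatic edge is removed. *)
Lemma selection_of_pf_coloring (G : sgraph) (k : nat) (c : G -> nat) :
    pf_coloring setT k c ->
  exists2 f : {ffun G -> {set {set G}}}, selection1 f &
    forall x y, removed_adj f x y -> c x != c y.
Proof.
move=> [ck cp].
have /fin_all_exists[g hg] : forall a : 'I_k, exists g : G -> G,
    {in [set x in setT | c x == a] &, forall x y, adj x y -> g x = y \/ g y = x}.
  by move=> a; exact: cp.
pose h x := g (Ordinal (ck x (in_setT x))) x.
(* Membership in [edges G] makes the selection empty when [h x] is not a neighbor of [x]. *)
exists [ffun x => [set e in edges G | e == [set x; h x]]].
  apply/forallP => v; rewrite ffunE; apply/andP; split.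
    apply/card_le1_eqP => e e'; rewrite !inE => /andP[_ /eqP->] /andP[_ /eqP->] //.
  by apply/subsetP => e; rewrite !inE => /andP[-> /eqP->]; rewrite !inE eqxx.
move=> x y /andP[xy]; apply: contraNneq => cxy.
have exy : [set x; y] \in edges G by apply/imsetP; exists (x, y); rewrite // inE.
have ecl : Ordinal (ck y (in_setT y)) = Ordinal (ck x (in_setT x)) by apply: val_inj.
have [||e|e] := hg (Ordinal (ck x (in_setT x))) x y _ _ xy; rewrite ?inE ?eqxx /= ?cxy //.
  by apply/bigcupP; exists x; rewrite // ffunE inE exy /h e eqxx.
by apply/bigcupP; exists y; rewrite // ffunE inE exy /h ecl e setUC eqxx.
Qed.

(** For the converse, a monochromatic edge must have been selected by one of its ends, and it is
    oriented away from that end. *)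
Lemma robust_le_pf_coloring (G : sgraph) (k : nat) :
  robust_chromatic_number G <= k <-> exists c, pf_coloring [set: G] k c.
Proof.
rewrite /robust_chromatic_number; case: ex_minnP => m /existsP[f /andP[sf /eqP fm]] min.
split=> [mk|[c hc]]; last first.
  have [f' sf' cf'] := selection_of_pf_coloring hc.
  have : chromatic_number (removed_subgraph f') <= k.
    by apply/chromatic_number_le; exists c; split=> // x; apply: (proj1 hc).
  by apply: leq_trans; apply: min; apply/existsP; exists f'; rewrite sf' eqxx.
have /chromatic_number_le[c [ck pc]] : chromatic_number (removed_subgraph f) <= k.
  by rewrite fm.
exists c; split=> // a.
(* This reads off the other end of the selected edge; the default [x] stands for an empty
   selection. *)
exists (fun x => odflt x [pick y | (y != x) && ([set x; y] \in f x)]).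
have G1 (x y : G) : x != y -> [set x; y] \in f x ->
    odflt x [pick y | (y != x) && ([set x; y] \in f x)] = y.
  move=> xy yf; case: pickP => [z /andP[zx zf]|/(_ y)]; last by rewrite yf eq_sym xy.
  have /forallP/(_ x)/andP[/card_le1_eqP /(_ _ _ zf yf) /setP/(_ z) + _] := sf.
  by rewrite !inE eqxx orbT (negbTE zx) /= => /eqP.
move=> x y; rewrite !inE => /eqP xa /eqP ya xy.
have ne : x != y by apply: contraTneq xy => ->; rewrite adj_irrefl.
have : ~~ removed_adj f x y by apply/negP => /pc; rewrite xa ya eqxx.
rewrite /removed_adj xy /= negbK => /bigcupP[v _ vf].
have /forallP/(_ v)/andP[_ /subsetP/(_ _ vf)] := sf.
rewrite !inE => /andP[_ /orP[]] /eqP e; subst v; first by left; apply: G1.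
by right; apply: G1; rewrite 1?eq_sym // setUC.
Qed.

(** Labels of [cl] carried by no vertex count as empty classes, so graphs with different numbers of
    classes can share one index type. *)
Lemma robust_le_cov (G : sgraph) (I : finType) (cl : G -> I) (k : nat) :
    (forall x y : G, adj x y = (cl x != cl y)) ->
  robust_chromatic_number G <= k <-> cov (cnt cl setT) k 0.
Proof.
move=> hcl; rewrite robust_le_pf_coloring; split=> [[c hc]|].
  by apply: cov_of_pf_coloring hc => x y; rewrite hcl.
by apply: pf_coloring_of_cov => x y; rewrite hcl.
Qed.

(** * Class sizes and the recursion for the robust chromatic number *)

Lemma eq_cov (I : finType) (n n' : I -> nat) (k s : nat) :
  n =1 n' -> cov n k s -> cov n' k s.
Proof.
move=> nn [l [d [q [r [h1 h2 h3]]]]]; exists l, d, q, r; split=> //.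
by under eq_bigr => i _ do rewrite -nn.
Qed.

(** For [j] beyond the end of [s] both sides are 0, the right one by the default of [nth]. *)
Lemma cnt_multipartite (s : seq nat) (I : finType)
    (cl : complete_multipartite s -> I) (j : nat) (i : I) :
    (forall x, (cl x == i) = (tag x == j :> nat)) ->
  cnt cl setT i = nth 0 s j.
Proof.
move=> hcl; have [js|js] := ltnP j (size s); last first.
  rewrite nth_default //; apply/eqP; rewrite cards_eq0; apply/eqP/setP => x.
  by rewrite !inE hcl ltn_eqF // (leq_trans (ltn_ord _) js).
pose F (u : 'I_(nth 0 s (Ordinal js))) : complete_multipartite s := Tagged _ u.
have Finj : injective F by move=> u v /eqP; rewrite eq_Tagged => /eqP.
rewrite -[RHS]card_ord -[RHS](card_imset _ Finj).
apply: eq_card => -[a u]; rewrite !inE hcl /=.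
apply/eqP/imsetP => [aj|[v _ /(congr1 (fun z => val (tag z)))] //].
have e : a = Ordinal js by apply: val_inj.
by subst a; exists u.
Qed.

Lemma robust_le_chromatic (G : sgraph) (f : {ffun G -> {set {set G}}}) :
  selection1 f -> robust_chromatic_number G <= chromatic_number (removed_subgraph f).
Proof.
move=> sf; rewrite /robust_chromatic_number; case: ex_minnP => m _; apply.
by apply/existsP; exists f; rewrite sf eqxx.
Qed.

Theorem theorem1p5 (t : nat) (n : nat -> nat) (ht : 2 <= t)
    (hpos : 1 <= n 1)
    (hmono : forall i j, 1 <= i -> i <= j -> j <= t -> n i <= n j)
    (hnt : 3 <= n t) :
  let s := [seq n i | i <- index_iota 1 t.+1] in
  let K := complete_multipartite s in
  [/\ exists f : {ffun K -> {set {set K}}},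
        [/\ selection1 f,
            chromatic_number (removed_subgraph f) = robust_chromatic_number K
          & exists c : {ffun removed_subgraph f ->
                          'I_(chromatic_number (removed_subgraph f))},
              proper_coloring c /\
              exists a, exists2 v1 : K, v1 \in vertex_class s 1 &
                [set x | c x == a] = vertex_class s t :|: [set v1]],
      robust_chromatic_number K =
        1 + robust_chromatic_number
              (complete_multipartite
                 (n 1 - 1 :: [seq n i | i <- index_iota 2 t]))
    & n 1 = 1 ->
      robust_chromatic_number K =
        1 + robust_chromatic_number
              (complete_multipartite [seq n i | i <- index_iota 2 t])].
Proof.
move=> s K.
set s' := _ :: _; set s2 := map _ _.
pose K' := complete_multipartite s'; pose K2 := complete_multipartite s2.
have size_s : size s = t by rewrite size_map size_iota subSS subn0.
have size_s2 : size s2 = t - 2 by rewrite size_map size_iota.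
have size_s' : size s' <= t by rewrite /= size_s2; lia.
have nth_s j : j < t -> nth 0 s j = n j.+1.
  by move=> jt; rewrite (nth_map 0) ?size_iota ?nth_iota //; lia.
have nth_s2 j : j < t - 2 -> nth 0 s2 j = n j.+2.
  by move=> jt; rewrite (nth_map 0) ?size_iota ?nth_iota //; lia.
pose i1 : 'I_t := Ordinal (ltnW ht).
have tt : t.-1 < t by lia.
pose it : 'I_t := Ordinal tt.
have i1t : i1 != it by rewrite -val_eqE /=; lia.
pose N (i : 'I_t) := n i.+1.
(* The sizes of [K'] over the index type of [K]: the last class is emptied and the first loses a
   vertex. *)
pose N' := upd (upd N it 0) i1 (N i1).-1.
pose cl (x : K) : 'I_t := cast_ord size_s (tag x).
pose cl' (x : K') : 'I_t := widen_ord size_s' (tag x).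
have lt2 (x : K2) : (tag x).+1 < t.
  by have := ltn_ord (tag x); rewrite [X in _ < X]size_s2; lia.
(* Tags are shifted by one, as the first class of [K2] is V_2. *)
pose cl2 (x : K2) : 'I_t := Ordinal (lt2 x).
have adjK (x y : K) : adj x y = (cl x != cl y) by rewrite -val_eqE.
have adjK' (x y : K') : adj x y = (cl' x != cl' y) by rewrite -val_eqE.
have adjK2 (x y : K2) : adj x y = (cl2 x != cl2 y) by rewrite -val_eqE.
have cntK : cnt cl setT =1 N.
  by move=> i; rewrite (@cnt_multipartite s _ cl i i) ?nth_s.
have cntK' : cnt cl' setT =1 N'.
  move=> i; rewrite (@cnt_multipartite s' _ cl' i i); last by move=> x; rewrite -val_eqE.
  rewrite /N' /upd -!val_eqE /=; case: i => [[|j] jt] /=; first by rewrite subn1.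
  have [e|ne] := eqVneq j.+1 t.-1; first by rewrite nth_default // size_s2; lia.
  by rewrite nth_s2 //; lia.
have cntK2 : n 1 = 1 -> cnt cl2 setT =1 N'.
  (* For [i = 0] the index [t] is out of range, so [nth] gives 0, which is [n 1 - 1]. *)
  move=> n1 i; rewrite (@cnt_multipartite s2 _ cl2 (if i == 0 :> nat then t else i.-1)).
    rewrite /N' /upd -!val_eqE /= /N /= n1; case: i => [[|j] jt] /=.
      by rewrite nth_default // size_s2; lia.
    have [e|ne] := eqVneq j.+1 t.-1; first by rewrite nth_default // size_s2; lia.
    by rewrite nth_s2 //; lia.
  move=> x; rewrite -val_eqE /=; have := lt2 x; case: i => [[|j] jt] /=; lia.
have leK k : robust_chromatic_number K <= k <-> cov N k 0.
  rewrite (robust_le_cov _ adjK); split; apply: eq_cov => // i; exact/esym.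
have leK' k : robust_chromatic_number K' <= k <-> cov N' k 0.
  rewrite (robust_le_cov _ adjK'); split; apply: eq_cov => // i; exact/esym.
have leK2 k : n 1 = 1 -> robust_chromatic_number K2 <= k <-> cov N' k 0.
  move=> n1; rewrite (robust_le_cov _ adjK2); split; apply: eq_cov => i; first exact: cntK2.
  exact/esym/cntK2.
(* Deleting the largest class saves a part but leaves a slack place, which deleting a vertex of the
   smallest class then removes. *)
have lower : robust_chromatic_number K' < robust_chromatic_number K.
  have Nmax i : N i <= N it by apply: hmono => //=; have := ltn_ord i; lia.
  have Nt : 2 < N it by rewrite /N /= prednK // ltnW.
  have [k0 ck] := cov_remove_max i1t Nmax Nt (proj1 (leK _) (leqnn _)).
  rewrite -[X in _ < X](prednK k0) ltnS leK'.
  have e : upd N it 0 i1 = N i1 by rewrite upd_neq.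
  rewrite /N' -{}e; apply: (cov_decr_min i1t) ck; first by rewrite upd_neq.
  move=> i; rewrite (upd_neq _ _ i1t) /upd; case: eqP => // _ _.
  by apply: hmono => //=; have := ltn_ord i; lia.
have [v1] : exists v1, v1 \in [set x in [set: K] | cl x == i1].
  by apply/set0Pn; rewrite -card_gt0; have := cntK i1; rewrite /cnt => ->.
rewrite !inE => /eqP clv1.
(* The intended color class: V_t and [v1] form a star centered at [v1]. *)
pose X : {set K} := [set x | cl x == it] :|: [set v1].
have pX : pseudoforest X.
  exists (fun=> v1) => x y; rewrite !inE adjK => /orP[/eqP xt|/eqP->]; last by right.
  by case/orP=> [/eqP yt|/eqP->]; [rewrite xt yt eqxx|left].
have cX i : cnt cl (setT :\: X) i = N' i.
  rewrite cntD ?subsetT // cntK /N' /upd.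
  have [->|ni1] := eqVneq i i1.
    have -> : cnt cl X i1 = 1; last by rewrite subn1.
    apply/eqP/cards1P; exists v1; apply/setP => x; rewrite !inE.
    have [->|xv] := eqVneq x v1; first by rewrite clv1 eqxx orbT.
    by rewrite orbF; case: eqP => //= ->; rewrite eq_sym (negbTE i1t).
  have [->|nit] := eqVneq i it.
    apply/eqP; rewrite subn_eq0 -cntK; apply/subset_leq_card/subsetP => x.
    by rewrite !inE => /eqP->; rewrite !eqxx.
  rewrite [X in _ - X](_ : _ = 0) ?subn0 //; apply/eqP; rewrite cards_eq0.
  apply/eqP/setP => x; rewrite !inE; apply/negP => /andP[/orP[]/eqP e] /eqP xi.
    by rewrite -xi e eqxx in nit.
  by rewrite -xi e clv1 eqxx in ni1.
(* The rest has sizes [N'], so it is colored optimally as [K'] would be; [X] gets one new color. *)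
have [c hc] : exists c, pf_coloring (setT :\: X) (robust_chromatic_number K') c.
  apply: (@pf_coloring_of_cov _ _ cl); first by move=> x y; rewrite adjK.
  by apply: (eq_cov (fun i => esym (cX i))); apply/leK'.
have hc' := pf_coloring_extend pX hc.
have [f sf pf] := selection_of_pf_coloring hc'.
have upper : chromatic_number (removed_subgraph f) <= (robust_chromatic_number K').+1.
  by apply/chromatic_number_le;
    exists (fun x => if x \in X then robust_chromatic_number K' else c x);
    split=> // x; apply: (proj1 hc').
have low := robust_le_chromatic sf.
have eK : robust_chromatic_number K = 1 + robust_chromatic_number K' by lia.
have ef : chromatic_number (removed_subgraph f) = (robust_chromatic_number K').+1 by lia.
split=> //; last first.
  (* [K'] and [K2] have the same upper bounds, both given by covers of [N']. *)
  by move=> n1; rewrite eK; congr (1 + _); apply/eqP; rewrite eqn_leq; apply/andP; split;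
    [apply/leK'/(leK2 _ n1)|apply/(leK2 _ n1)/leK'].
exists f; split=> //; first by rewrite ef eK.
pose col (x : removed_subgraph f) := if x \in X then robust_chromatic_number K' else c x.
have colt x : col x < chromatic_number (removed_subgraph f).
  by rewrite ef; apply: (proj1 hc').
exists [ffun x => Ordinal (colt x)]; split.
  apply/forallP => x; apply/forallP => y; apply/implyP => xy.
  by rewrite !ffunE -val_eqE /=; apply: pf.
exists (Ordinal (colt v1)), v1.
  by have := congr1 val clv1; rewrite inE /= => ->.
apply/setP => x; rewrite !inE ffunE -val_eqE /= /col.
have -> : v1 \in X by rewrite !inE eqxx orbT.
have -> : ((tag x).+1 == t) = (cl x == it) by rewrite -val_eqE /=; lia.
case: (boolP (x \in X)) => xX; first by move: xX; rewrite eqxx !inE => ->.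
have := proj1 hc x; rewrite inE xX in_setT => /(_ isT) cx.
by rewrite ltn_eqF //; move: xX; rewrite !inE => /negbTE->.
Qed.
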